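(* For all integers $n,k\ge 0$, the map $\phi'$ defined below restricts to a bijection from the set of bilateral Dyck paths of semilength $n$ with $k$ up-steps at odd height onto the set of bilateral Dyck paths of semilength $n$ with $k$ peaks. Definition of $\phi'$: (a) if $W$ is a Dyck word, $\phi'(W)=\phi(W)$; (b) if $W$ is a negative Dyck word, $\phi'(W)=\alpha(\phi(\beta(\alpha(W))))$; (c) if the path of $W$ has $l>0$ crossings, $W$ decomposes uniquely as $W=W_1W_2\cdots W_{l+1}$ where the $W_i$ are alternately nonempty Dyck words and negative Dyck words, and $\phi'(W)=\phi'(W_1)\phi'(W_2)\cdots\phi'(W_{l+1})$. Here: $\alpha$ replaces every $U$ by $D$ and every $D$ by $U$ (reflection in the $x$-axis). $\beta$ is defined on Dyck words: a nonempty Dyck word decomposes uniquely as $UW_1DW_2$ with $W_1,W_2$ Dyck words, and $\beta(UW_1DW_2)=UW_2DW_1$. $\phi$ is defined on Dyck words by $\phi(\epsilon)=\epsilon$ and, for a nonempty Dyck word $W$ whose path has $s\ge0$ down-steps at height $2$ before its first contact, with unique decomposition $W=U\big(\prod_{i=1}^{s}UW_iD\big)DW_{s+1}$ ($W_i$ Dyck words), $\phi(W)=\big(\prod_{i=1}^{s}U\,\phi(W_i)\big)\,UD\,D^{s}\,\phi(W_{s+1})$.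
   Context: Paths have steps $(1,1)$ (up-step, letter $U$) and $(1,-1)$ (down-step, letter $D$), start at $(0,0)$; paths and words in $\{U,D\}$ are identified, $\epsilon$ is the empty word, products denote concatenation and $D^s$ is $s$ copies of $D$. A bilateral Dyck path is such a path ending on the line $y=0$ (no other restriction). A Dyck path is a bilateral Dyck path with no vertex of negative $y$-coordinate; a negative Dyck path is a bilateral Dyck path of nonzero length with no vertex of positive $y$-coordinate. The semilength is half the number of steps. An up-step is at height $j$ if it goes from $(i-1,j-1)$ to $(i,j)$; a down-step is at height $j$ if it goes from $(i,j)$ to $(i+1,j-1)$; it is at odd height if $j$ is odd. A peak is an up-step immediately followed by a down-step. A contact is a down-step at height $1$ or an up-step at height $0$. A crossing is a down-step at height $1$ immediately followed by a down-step at height $0$, or an up-step at height $0$ immediately followed by an up-step at height $1$. *)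

(* Defs.v *)
(* Words in {U,D} are encoded as seq bool: U = true, D = false. *)
From mathcomp Require Import all_boot all_order all_algebra.
Set Implicit Arguments. Unset Strict Implicit. Unset Printing Implicit Defensive.
Import Order.TTheory GRing.Theory Num.Theory.

Local Open Scope ring_scope.

Definition step (b : bool) : int := if b then 1 else -1.

Definition height (w : seq bool) : int := \sum_(b <- w) step b.

Definition bilateral (w : seq bool) : bool := height w == 0.

Definition dyck (w : seq bool) : bool :=
  bilateral w && [forall i : 'I_(size w).+1, 0 <= height (take i w)].

Definition neg_dyck (w : seq bool) : bool :=
  [&& size w != 0%N, bilateral w & [forall i : 'I_(size w).+1, height (take i w) <= 0]].

(* number of up-steps at odd height (an up-step from (i-1,j-1) to (i,j) is at height j) *)
Fixpoint oddups_from (h : int) (w : seq bool) : nat :=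
  match w with
  | [::] => 0%N
  | b :: w' => ((b && odd (absz (h + step b)%R)) + oddups_from (h + step b) w')%N
  end.
Definition oddups (w : seq bool) : nat := oddups_from 0 w.

Fixpoint peaks (w : seq bool) : nat :=
  match w with
  | b :: ((c :: _) as w') => ((b && ~~ c) + peaks w')%N
  | _ => 0%N
  end.

Definition alpha (w : seq bool) : seq bool := map negb w.

Fixpoint split_prime_from (h : int) (acc w : seq bool) : seq bool * seq bool :=
  match w with
  | [::] => (rev acc, [::])
  | b :: w' =>
      if h + step b == 0 then (rev (b :: acc), w')
      else split_prime_from (h + step b) (b :: acc) w'
  end.
Definition split_prime (w : seq bool) := split_prime_from 0 [::] w.

Definition strip (w : seq bool) : seq bool := take (size w - 2) (drop 1 w).

Fixpoint primes_f (f : nat) (w : seq bool) : seq (seq bool) :=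
  match f with
  | 0%N => [::]
  | f'.+1 => match w with
             | [::] => [::]
             | _ => (split_prime w).1 :: primes_f f' (split_prime w).2
             end
  end.
Definition primes (w : seq bool) := primes_f (size w) w.

Definition beta (w : seq bool) : seq bool :=
  match w with
  | [::] => [::]
  | _ => true :: (split_prime w).2 ++ false :: strip (split_prime w).1
  end.

(* phi on Dyck words:
   W = U (prod_{i=1}^s U W_i D) D W_{s+1}  |->
   (prod_{i=1}^s U phi(W_i)) U D D^s phi(W_{s+1}).
   The U W_i D are the prime factors of the interior of the first prime factor. *)
Fixpoint phi_f (f : nat) (w : seq bool) : seq bool :=
  match f with
  | 0%N => [::]
  | f'.+1 =>
      match w with
      | [::] => [::]
      | _ =>
          let p := (split_prime w).1 in
          let r := (split_prime w).2 in
          let fs := primes (strip p) in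
          flatten [seq true :: phi_f f' (strip q) | q <- fs]
            ++ [:: true; false] ++ nseq (size fs) false ++ phi_f f' r
      end
  end.
Definition phi (w : seq bool) : seq bool := phi_f (size w) w.

(* group consecutive prime pieces lying on the same side of the x-axis:
   this yields the decomposition W = W_1 ... W_{l+1} at the l crossings *)
Fixpoint group_side (ps : seq (seq bool)) : seq (seq bool) :=
  match ps with
  | [::] => [::]
  | p :: ps' =>
      match group_side ps' with
      | g :: gs => if head true p == head true g then (p ++ g) :: gs
                   else p :: g :: gs
      | [::] => [:: p]
      end
  end.
Definition crossing_blocks (w : seq bool) := group_side (primes w).

Definition phi' (w : seq bool) : seq bool :=
  flatten [seq (if head true g then phi g else alpha (phi (beta (alpha g))))
          | g <- crossing_blocks w].

(* Main.v *)
(** A Dyck word is coded by a binary tree ([Node a b] for [U a D b]) and a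
    bilateral word by a list of nonempty trees on alternating sides of the axis,
    one per crossing block.  On trees [phi] becomes a recursion intertwined with
    an auxiliary map [phi_in], from which injectivity and the transport of
    statistics are read off: writing [o] and [e] for the numbers of up-steps at
    odd and even height, [phi] has [o] peaks.  On a negative block the reflected
    up-steps at odd height are the even ones, [beta] sends [e] to [o = e + 1],
    and reflecting the image turns its [e + 1] peaks into [e] peaks.  An injection
    of the finite set of bilateral words of given length is onto. *)
Require Import Defs.
From mathcomp Require Import all_boot all_order all_algebra.
From mathcomp Require Import zify.
Set Implicit Arguments. Unset Strict Implicit. Unset Printing Implicit Defensive.
Import GRing.Theory.

(** * Dyck words and their reflections as binary trees *)

Inductive dtree := Leaf | Node of dtree & dtree.

Definition nonleaf t := if t is Node _ _ then true else false.

(* [word true t] is the Dyck word of [t], [word false t] its reflection. *)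
Fixpoint word s t : seq bool :=
  if t is Node a b then s :: word s a ++ ~~ s :: word s b else [::].

Fixpoint tcat t u := if t is Node a b then Node a (tcat b u) else u.

Lemma word_tcat s t u : word s (tcat t u) = word s t ++ word s u.
Proof. by elim: t => //= a _ b ->; rewrite -catA. Qed.

Lemma alpha_word s t : alpha (word s t) = word (~~ s) t.
Proof.
by elim: t => //= a IHa b IHb; rewrite /alpha map_cat /= -!/(alpha _) IHa IHb.
Qed.

Lemma height_cons b w : height (b :: w) = (step b + height w)%R.
Proof. by rewrite /height big_cons. Qed.

Lemma height_cat u v : height (u ++ v) = (height u + height v)%R.
Proof. by rewrite /height big_cat. Qed.

Lemma height_word s t : height (word s t) = 0%R.
Proof.
elim: t => [|a IHa b IHb] /=; first by rewrite /height big_nil.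
by rewrite height_cons height_cat height_cons IHa IHb; case: s {IHa IHb}.
Qed.

Lemma head_word b s t : nonleaf t -> head b (word s t) = s.
Proof. by case: t. Qed.

Lemma last_word b s t : nonleaf t -> last b (word s t) = ~~ s.
Proof.
elim: t b => //= a _ u IHu b _; rewrite last_cat /=.
by case: u IHu => //= c d; apply.
Qed.

(** * Prime factorisation *)

(* After its first step, a prime on side [s] has heights of the form
   [step s * m.+1] until it returns to the axis. *)
Lemma split_prime_from_word s t m acc w :
  split_prime_from (step s * m.+1%:Z)%R acc (word s t ++ w) =
  split_prime_from (step s * m.+1%:Z)%R (rev (word s t) ++ acc) w.
Proof.
elim: t m acc w => //= a IHa b IHb m acc w.
have -> : (step s * m.+1 + step s = step s * m.+2 :> int)%R by case: s {IHa IHb} => /=; lia.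
rewrite ifF; last by case: s {IHa IHb} => /=; lia.
rewrite -catA IHa /=.
have -> : (step s * m.+2 + step (~~ s) = step s * m.+1 :> int)%R by case: s {IHa IHb} => /=; lia.
rewrite ifF; last by case: s {IHa IHb} => /=; lia.
by rewrite IHb rev_cons rev_cat rev_cons cat_rcons -!cats1 -!catA.
Qed.

Definition prime_word (p : bool * dtree) := p.1 :: word p.1 p.2 ++ [:: ~~ p.1].

Lemma split_prime_cat p w : split_prime (prime_word p ++ w) = (prime_word p, w).
Proof.
case: p => s t; rewrite /split_prime /prime_word /= ifF; last by case: s.
have -> : (0 + step s = step s * 1%N)%R by case: s.
rewrite -catA split_prime_from_word /= ifT; last by case: s.
by rewrite rev_cons rev_cat revK /= -cats1.
Qed.

Lemma strip_prime p : strip (prime_word p) = word p.1 p.2.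
Proof.
case: p => s t; rewrite /strip /prime_word /= size_cat /= addn1 subn2 /= drop0.
by rewrite take_size_cat.
Qed.

Lemma word_Node s a b : word s (Node a b) = prime_word (s, a) ++ word s b.
Proof. by rewrite /prime_word /= -catA. Qed.

(** [split_prime] recovers the first prime and the remainder, hence inductively both subtrees. *)
Lemma word_inj s : injective (word s).
Proof.
elim=> [|a IHa b IHb] [|c d] //; rewrite !word_Node => E.
move: (congr1 split_prime E); rewrite !split_prime_cat => -[].
(* Cancelling the closing step needs interiors of equal length, which the first primes of [E]
   provide. *)
move/eqP; rewrite eqseq_cat ?eqxx ?andbT; last first.
  by move: (congr1 (fun w => size (split_prime w).1) E);
     rewrite !split_prime_cat /= !size_cat /=; lia.
by move/eqP/IHa=> -> /IHb ->.
Qed.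

Lemma primes_f_prime_words f ps :
  size (flatten (map prime_word ps)) <= f ->
  primes_f f (flatten (map prime_word ps)) = map prime_word ps.
Proof.
elim: f ps => [|f IHf] [|p ps] //=; rewrite -/(prime_word p) => lef.
by rewrite -cat_cons -/(prime_word p) split_prime_cat /= IHf //;
   move: lef; rewrite !size_cat /=; lia.
Qed.

Lemma primes_prime_words ps :
  Defs.primes (flatten (map prime_word ps)) = map prime_word ps.
Proof. exact: primes_f_prime_words. Qed.

Fixpoint factors t := if t is Node a b then a :: factors b else [::].

Lemma word_factors s t :
  word s t = flatten (map prime_word (map (pair s) (factors t))).
Proof. by elim: t => //= a _ b ->; rewrite -catA. Qed.

Lemma primes_word s t : Defs.primes (word s t) = map prime_word (map (pair s) (factors t)).
Proof. by rewrite word_factors primes_prime_words. Qed.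

(** * The map [phi] on trees *)

(* [phiT] is [phi], and [U (phi_in a) D] is the first prime of [phi (U a D b)]. *)
Fixpoint phi2 t : dtree * dtree :=
  if t is Node a b then
    (Node (phi2 a).2 (phi2 b).1, tcat (phi2 a).1 (Node (phi2 b).2 Leaf))
  else (Leaf, Leaf).
Definition phiT t := (phi2 t).1.
Definition phi_in t := (phi2 t).2.
Arguments phiT : simpl never.
Arguments phi_in : simpl never.

Lemma phiT_Node a b : phiT (Node a b) = Node (phi_in a) (phiT b).
Proof. by []. Qed.

Lemma phi_in_Node a b : phi_in (Node a b) = tcat (phiT a) (Node (phi_in b) Leaf).
Proof. by []. Qed.

(** The factors of [a] code the words [W_1, ..., W_s] in the definition of [phi], and [b] codes
    [W_{s+1}]. *)
Lemma phi_f_Node f a b :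
  phi_f f.+1 (word true (Node a b)) =
  flatten [seq true :: phi_f f (word true c) | c <- factors a] ++
    [:: true; false] ++ nseq (size (factors a)) false ++ phi_f f (word true b).
Proof.
rewrite [LHS]/= -[in LHS]cat1s.
rewrite (_ : split_prime _ = (prime_word (true, a), word true b)); last first.
  by rewrite -split_prime_cat /prime_word /= -catA.
rewrite strip_prime primes_word !size_map -!map_comp.
by congr (flatten _ ++ _); apply: eq_map => c /=; rewrite strip_prime.
Qed.

Lemma phi_f_word f t : size (word true t) <= f -> phi_f f (word true t) = word true (phiT t).
Proof.
elim: f t => [|f IHf] [|a b] // lef.
have {}lef : size (word true a) + size (word true b) <= f.
  by move: lef; rewrite /= size_cat /=; lia.
rewrite phi_f_Node phiT_Node word_Node IHf; last by lia.
have {}lef : size (word true a) <= f by lia.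
rewrite !catA; congr (_ ++ _); rewrite -catA.
(* It remains to see [U phi(W_1) ... U phi(W_s) U D D^s] as the prime with interior [phi_in a].
   Peeling off [U phi(W_1)] leaves the same product for [d], followed by one more [D]. *)
elim: a lef => [|c _ d IHd] // lef.
have {}lef : size (word true c) + size (word true d) <= f.
  by move: lef; rewrite /= size_cat /=; lia.
rewrite /= IHf; last by lia.
rewrite phi_in_Node /prime_word /= word_tcat -!catA; congr (_ :: _ ++ _).
rewrite word_Node cats0 -IHd; last by lia.
rewrite -catA; congr (_ ++ _ :: _ :: _).
by elim: (size _) => //= m ->.
Qed.

Lemma phi_word t : phi (word true t) = word true (phiT t).
Proof. exact: phi_f_word. Qed.

(** [Node y Leaf] ends the right spine: it is the last prime factor, which the whole tree
    determines. *)
Lemma tcat_Node_inj x y x' y' :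
  tcat x (Node y Leaf) = tcat x' (Node y' Leaf) -> x = x' /\ y = y'.
Proof.
elim: x x' => [|a _ b IHb] [|a' b'] //=; first by case.
- by case: b' => [|? ?] [].
- by case: b {IHb} => [|? ?] [].
by case=> -> /IHb [-> ->].
Qed.

(** The two recursions call each other, so both injectivities are proved in one induction. *)
Lemma phi2_inj t u : (phiT t = phiT u -> t = u) /\ (phi_in t = phi_in u -> t = u).
Proof.
elim: t u => [|a IHa b IHb] [|c d]; split=> //.
- by rewrite phi_in_Node; case: (phiT c).
- by rewrite phi_in_Node; case: (phiT a).
- by rewrite !phiT_Node => -[/(IHa c).2 -> /(IHb d).1 ->].
- by rewrite !phi_in_Node => /tcat_Node_inj[/(IHa c).1 -> /(IHb d).2 ->].
Qed.

Lemma phiT_inj : injective phiT.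
Proof. by move=> t u; case: (phi2_inj t u). Qed.

Fixpoint tsize t := if t is Node a b then (tsize a + tsize b).+1 else 0.

Lemma size_word_tsize s t : size (word s t) = (tsize t).*2.
Proof. by elim: t => //= a IHa b IHb; rewrite size_cat /= IHa IHb; lia. Qed.

Lemma tsize_tcat t u : tsize (tcat t u) = tsize t + tsize u.
Proof. by elim: t => //= a _ b ->; lia. Qed.

Lemma tsize_phi2 t : tsize (phiT t) = tsize t /\ tsize (phi_in t) = tsize t.
Proof.
elim: t => // a [IHa IHa'] b [IHb IHb'].
by rewrite phiT_Node phi_in_Node tsize_tcat /= IHa IHa' IHb IHb'; split; lia.
Qed.

(** * Statistics *)

(** Up-steps of [word true t] at odd and at even height; those of [a] trade places because its word
    is raised by one. *)
Fixpoint odd_even_ups t : nat * nat :=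
  if t is Node a b then (((odd_even_ups a).2 + (odd_even_ups b).1).+1,
     (odd_even_ups a).1 + (odd_even_ups b).2)
  else (0, 0).

Lemma odd_absz_step h b : odd (absz (h + step b)%R) = ~~ odd (absz h).
Proof. by case: b => /=; lia. Qed.

(** Reflection turns a down-step at height [j] into an up-step at height [1 - j], of the other
    parity; an odd starting height also swaps parities. *)
Lemma oddups_from_word h s t w :
  oddups_from h (word s t ++ w) =
  (if odd (absz h) (+) s then (odd_even_ups t).1 else (odd_even_ups t).2) + oddups_from h w.
Proof.
elim: t h w => [|a IHa b IHb] h w /=; first by case: ifP.
rewrite -catA IHa /= !odd_absz_step.
have -> : (h + step s + step (~~ s) = h)%R by case: s {IHa IHb} => /=; lia.
by rewrite IHb; case: s {IHa IHb}; case: (odd _) => /=; lia.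
Qed.

(** The defaults [false] and [true] keep an empty word from creating a peak at the seam. *)
Lemma peaks_cat u v :
  peaks (u ++ v) = peaks u + (last false u && ~~ head true v) + peaks v.
Proof.
elim: u => [|b [|c u] IHu] //=; last by rewrite /= in IHu; rewrite IHu; lia.
by case: v {IHu} => [|c v] /=; rewrite ?andbF.
Qed.

Lemma peaks_cons b w : peaks (b :: w) = (b && ~~ head true w) + peaks w.
Proof. by case: w => //=; rewrite andbF. Qed.

Lemma peaks_word_Node a b :
  peaks (word true (Node a b)) =
  (if nonleaf a then peaks (word true a) else 1) + peaks (word true b).
Proof.
rewrite [word _ (Node _ _)]/= peaks_cons peaks_cat peaks_cons /= andbT.
case: a => [|a a'] //; rewrite last_word //=; lia.
Qed.

(** Peaks of the reflection are valleys, and a nonempty Dyck path has one more peak than valleys. *)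
Lemma peaks_reflect t :
  peaks (word true t) = peaks (word false t) + nonleaf t.
Proof.
elim: t => // a IHa b IHb.
rewrite peaks_word_Node [word _ (Node _ _)]/= peaks_cons peaks_cat peaks_cons /=.
rewrite andbF IHa IHb; case: a b {IHa IHb} => [|a a'] [|b b'] //=; lia.
Qed.

(** The interior [phi_in t] is counted with its enclosing [U] and [D], since an empty interior still
    yields a peak. *)
Lemma peaks_phi2 t :
  peaks (word true (phiT t)) = (odd_even_ups t).1 /\
  peaks (word true (Node (phi_in t) Leaf)) = (odd_even_ups t).2.+1.
Proof.
elim: t => // a [IHa IHa'] b [IHb IHb'].
have E : nonleaf (tcat (phiT a) (Node (phi_in b) Leaf)) by case: (phiT a).
have PL : peaks (word true Leaf) = 0 by [].
split.
  rewrite phiT_Node peaks_word_Node IHb /=.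
  by move: IHa'; rewrite peaks_word_Node PL; lia.
rewrite phi_in_Node peaks_word_Node E PL.
rewrite word_tcat peaks_cat IHa IHb' /=.
by rewrite andbF; lia.
Qed.

(** * Crossing blocks *)

Definition block (g : bool * dtree) := word g.1 g.2.

Fixpoint alternating (gs : seq (bool * dtree)) : bool :=
  if gs is g :: gs' then
    [&& nonleaf g.2, (if gs' is g' :: _ then g.1 != g'.1 else true) & alternating gs']
  else true.

Definition blocks_word gs := flatten (map block gs).

Definition add_prime s a (gs : seq (bool * dtree)) :=
  if gs is (s', t) :: gs' then
    if s == s' then (s, Node a t) :: gs' else (s, Node a Leaf) :: gs
  else [:: (s, Node a Leaf)].

Lemma add_prime_word s a gs :
  blocks_word (add_prime s a gs) = prime_word (s, a) ++ blocks_word gs.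
Proof.
rewrite /blocks_word /prime_word; case: gs => [|[s' t] gs] /=.
  by rewrite cats0.
by case: eqP => [->|_] /=; rewrite /block /= -!catA.
Qed.

Lemma add_prime_alternating s a gs :
  alternating gs -> alternating (add_prime s a gs).
Proof.
case: gs => [|[s' t] gs] //=; case: eqP => [->|/eqP ns] /=; first by case/and3P=> _ -> ->.
by rewrite ns.
Qed.

(* A word read from right to left: before the closed part [gs] stands the list [ts]
   of subtrees separated by the steps [~~ s] that still await a partner [s]. *)
Definition pending s (ts : seq dtree) := flatten [seq rcons (word s t) (~~ s) | t <- ts].

Lemma pending_exists w :
  exists s ts gs, alternating gs /\ w = pending s ts ++ blocks_word gs.
Proof.
elim: w => [|b w [s [ts [gs [alt ->]]]]]; first by exists true, [::], [::].
case: (eqVneq b s) => [->|nbs]; last first.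
  exists s, (Leaf :: ts), gs; split=> //=; congr (_ :: _).
  by case: b s nbs {ts} => [] [].
(* With nothing pending, the step [s] itself becomes pending and the side switches; with one entry
   it closes a prime in front of [gs]; otherwise it joins the first two entries. *)
case: ts => [|t [|u ts]].
- by exists (~~ s), [:: Leaf], gs; split=> //=; rewrite /pending /= negbK.
- exists s, [::], (add_prime s t gs); split; first exact: add_prime_alternating.
  by rewrite add_prime_word /pending /prime_word /= cats0 -cats1.
exists s, (Node t u :: ts), gs; split=> //.
by rewrite /pending /= -!cats1 -!catA.
Qed.

Lemma height_blocks_word gs : height (blocks_word gs) = 0%R.
Proof.
rewrite /blocks_word; elim: gs => [|g gs IH] /=; first by rewrite /height big_nil.
by rewrite height_cat IH height_word.
Qed.

Lemma height_pending s ts : height (pending s ts) = (step (~~ s) * (size ts)%:Z)%R.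
Proof.
rewrite /pending; elim: ts => [|t ts IH] /=; first by rewrite /height big_nil mulr0.
rewrite height_cat -cats1 height_cat height_word IH height_cons /height big_nil.
by case: s {IH} => /=; lia.
Qed.

Lemma bilateral_blocks w :
  bilateral w -> exists2 gs, alternating gs & w = blocks_word gs.
Proof.
have [s [ts [gs [alt ->]]]] := pending_exists w.
rewrite /bilateral height_cat height_blocks_word height_pending => /eqP h0.
(* All unmatched steps have the same sign, so height zero leaves none. *)
exists gs => //; case: ts h0 => //= t ts; case: s => /=; lia.
Qed.

Lemma group_side_cons p ps g gs :
  group_side ps = g :: gs ->
  group_side (p :: ps) =
  if head true p == head true g then (p ++ g) :: gs else p :: g :: gs.
Proof. by move=> /= ->. Qed.

(** The condition on the first group of [ps] stops it from merging with the primes of [t]. *)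
Lemma group_side_factors s t ps :
  nonleaf t ->
  (if group_side ps is g :: _ then s != head true g else true) ->
  group_side (map prime_word (map (pair s) (factors t)) ++ ps) =
  word s t :: group_side ps.
Proof.
elim: t => // a _ b IHb _ nh; rewrite word_Node.
case: b IHb => [_|c d IHb].
  rewrite [word _ Leaf]/= cats0 /=; case: (group_side ps) nh => [|g gs] //.
  by move/negbTE->.
by rewrite (group_side_cons _ (IHb isT nh)) /= eqxx.
Qed.

Lemma blocks_word_primes gs :
  blocks_word gs =
  flatten (map prime_word (flatten [seq map (pair g.1) (factors g.2) | g <- gs])).
Proof.
rewrite /blocks_word; elim: gs => //= g gs ->.
by rewrite map_cat flatten_cat -word_factors.
Qed.

Lemma crossing_blocks_word gs :
  alternating gs -> crossing_blocks (blocks_word gs) = map block gs.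
Proof.
rewrite /crossing_blocks blocks_word_primes primes_prime_words.
elim: gs => //= -[s t] gs IH /and3P[/= nt ns alt].
rewrite map_cat group_side_factors ?IH //.
by case: gs ns alt {IH} => //= -[s' t'] gs /= ns /and3P[/= nt' _ _]; rewrite head_word.
Qed.

Lemma block_inj g g' : nonleaf g.2 -> nonleaf g'.2 -> block g = block g' -> g = g'.
Proof.
case: g g' => [s t] [s' t'] /= nt nt'; rewrite /block /= => E.
have Es : s = s' by rewrite -(head_word true s nt) E head_word.
by move: E; rewrite Es => /word_inj ->.
Qed.

Lemma blocks_word_inj gs gs' :
  alternating gs -> alternating gs' -> blocks_word gs = blocks_word gs' -> gs = gs'.
Proof.
move=> alt alt' /(congr1 crossing_blocks); rewrite !crossing_blocks_word //.
elim: gs gs' alt alt' => [|g gs IH] [|g' gs'] //= /and3P[ng _ alt] /and3P[ng' _ alt'].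
by case=> /block_inj -> // /IH ->.
Qed.

(** * The map [phi'] on blocks *)

Definition betaT t := if t is Node a b then Node b a else Leaf.

(** A negative block stores the tree of its reflection, so the side absorbs both uses of [alpha]. *)
Definition phi_block (g : bool * dtree) := (g.1, phiT (if g.1 then g.2 else betaT g.2)).

Lemma beta_word t : beta (word true t) = word true (betaT t).
Proof.
case: t => // a b; rewrite /beta word_Node split_prime_cat strip_prime /=.
by case: (word _ b).
Qed.

Lemma phi'_blocks gs :
  alternating gs -> phi' (blocks_word gs) = blocks_word (map phi_block gs).
Proof.
move=> alt; rewrite /phi' crossing_blocks_word // /blocks_word -!map_comp.
elim: gs alt => //= -[s t] gs IH /and3P[/= nt _ /IH ->].
rewrite /block /= head_word //; congr (_ ++ _); case: s => /=; first by rewrite phi_word.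
by rewrite alpha_word beta_word phi_word alpha_word.
Qed.

Lemma nonleaf_phi_block g : nonleaf (phi_block g).2 = nonleaf g.2.
Proof. by case: g => [[] []]. Qed.

Lemma alternating_phi gs : alternating (map phi_block gs) = alternating gs.
Proof. by elim: gs => //= g gs ->; rewrite nonleaf_phi_block; case: gs. Qed.

Lemma phi_block_inj : injective phi_block.
Proof.
move=> [s t] [s' t'] [<-] /phiT_inj; case: s => [->//|].
by case: t t' => [|a b] [|c d] //= [-> ->].
Qed.

Lemma size_phi_block g : size (block (phi_block g)) = size (block g).
Proof.
case: g => [s t]; rewrite /block /= !size_word_tsize (tsize_phi2 _).1.
by case: s t => [] [|a b] //=; lia.
Qed.

Lemma size_phi_blocks gs : size (blocks_word (map phi_block gs)) = size (blocks_word gs).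
Proof.
rewrite /blocks_word; elim: gs => //= g gs IH.
by rewrite !size_cat IH size_phi_block.
Qed.

Lemma peaks_phi_block g :
  nonleaf g.2 ->
  peaks (block (phi_block g)) = if g.1 then (odd_even_ups g.2).1 else (odd_even_ups g.2).2.
Proof.
case: g => [[] [|a b]] //= _; rewrite /block /=; first exact: (peaks_phi2 (Node a b)).1.
move: (peaks_reflect (phiT (Node b a))); rewrite (peaks_phi2 _).1 /=; lia.
Qed.

(** No peak arises at a crossing: the last step of a block and the first step of the next have the
    same direction. *)
Lemma peaks_blocks_word gs :
  alternating gs -> peaks (blocks_word gs) = \sum_(g <- gs) peaks (block g).
Proof.
rewrite /blocks_word; elim: gs => [|g gs IH] /=; first by rewrite big_nil.
case/and3P=> ng ns alt; rewrite big_cons peaks_cat IH // last_word //.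
case: gs ns alt {IH} => [|g' gs] /= ns; first by rewrite andbF addn0.
case/and3P=> ng' _ _; suff -> : head true (block g' ++ flatten (map block gs)) = g'.1.
  by case: g.1 g'.1 ns => [] [] //=; rewrite addn0.
by case: g' ng' {ns} => [? []].
Qed.

Lemma oddups_blocks_word gs :
  oddups (blocks_word gs) =
  \sum_(g <- gs) if g.1 then (odd_even_ups g.2).1 else (odd_even_ups g.2).2.
Proof.
rewrite /blocks_word /oddups; elim: gs => [|g gs IH] /=; first by rewrite big_nil.
by rewrite big_cons oddups_from_word IH.
Qed.

(** * Transport of statistics and bijectivity *)

Lemma phi'_bilateral w : bilateral w -> bilateral (phi' w).
Proof.
move=> /bilateral_blocks[gs alt ->]; rewrite phi'_blocks //.
by rewrite /bilateral height_blocks_word.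
Qed.

Lemma size_phi' w : bilateral w -> size (phi' w) = size w.
Proof.
by move=> /bilateral_blocks[gs alt ->]; rewrite phi'_blocks // size_phi_blocks.
Qed.

Lemma peaks_phi' w : bilateral w -> peaks (phi' w) = oddups w.
Proof.
move=> /bilateral_blocks[gs alt ->]; rewrite phi'_blocks //.
rewrite peaks_blocks_word ?alternating_phi // oddups_blocks_word big_map.
elim: gs alt => [|g gs IH] /=; first by rewrite !big_nil.
by case/and3P=> ng _ /IH; rewrite !big_cons peaks_phi_block // => ->.
Qed.

Lemma phi'_inj w1 w2 : bilateral w1 -> bilateral w2 -> phi' w1 = phi' w2 -> w1 = w2.
Proof.
move=> /bilateral_blocks[gs1 alt1 ->] /bilateral_blocks[gs2 alt2 ->].
rewrite !phi'_blocks // => /blocks_word_inj; rewrite !alternating_phi.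
by move=> /(_ alt1 alt2) /(inj_map phi_block_inj) ->.
Qed.

Lemma phi'_onto v : bilateral v -> exists2 w, bilateral w & phi' w = v.
Proof.
move=> bv; pose m := size v.
(* Extending [phi'] by the identity gives a self-map of a finite type; the default of [insubd] never
   occurs, as [phi'] preserves size. *)
pose F (w : m.-tuple bool) : m.-tuple bool :=
  if bilateral w then insubd w (phi' w) else w.
have FE (w : m.-tuple bool) : bilateral w -> F w = phi' w :> seq bool.
  by move=> bw; rewrite /F bw val_insubd size_phi' // size_tuple eqxx.
have Fb (w : m.-tuple bool) : bilateral (F w) = bilateral w.
  by case bw: (bilateral w); [rewrite FE ?phi'_bilateral | rewrite /F bw].
have Finj : injective F.
  (* By [Fb], a bilateral and a non-bilateral word cannot have the same image. *)
  move=> w1 w2 E; have := Fb w1; rewrite E Fb => b12.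
  case b1: (bilateral w1) b12 => b2; last by move: E; rewrite /F b1 b2.
  by apply/val_inj/phi'_inj; rewrite // -!FE // E.
have [G _ GK] := injF_bij Finj.
have bG : bilateral (G (in_tuple v)) by rewrite -Fb GK.
by exists (G (in_tuple v)); rewrite // -FE // GK.
Qed.

Theorem theorem2 (n k : nat) :
  let A := fun w : seq bool => [&& bilateral w, size w == n.*2 & oddups w == k] in
  let B := fun w : seq bool => [&& bilateral w, size w == n.*2 & peaks w == k] in
  (forall w, A w -> B (phi' w)) /\
  (forall w1 w2, A w1 -> A w2 -> phi' w1 = phi' w2 -> w1 = w2) /\
  (forall v, B v -> exists2 w, A w & phi' w = v).
Proof.
move=> A B; split; [|split].
- move=> w /and3P[bw sw ow].
  by apply/and3P; split; rewrite ?phi'_bilateral ?size_phi' ?peaks_phi'.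
- by move=> w1 w2 /andP[b1 _] /andP[b2 _]; apply: phi'_inj.
move=> v /and3P[/phi'_onto[w bw <-]]; rewrite size_phi' // peaks_phi' // => sw ow.
by exists w => //; apply/and3P; split.
Qed.
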